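(* Let $\mathcal{C}$ be a clutter with vertex set $X=\{x_1,\ldots,x_n\}$, let $A$ be its incidence matrix, let $I=I(\mathcal{C})\subset R=K[x_1,\ldots,x_n]$ be its edge ideal, and let $Q(A)=\{x\in\mathbb{R}^n\mid x\ge 0,\ xA\ge\mathbf{1}\}$. Then $\mathcal{C}$ has the max-flow min-cut (MFMC) property if and only if $Q(A)$ is an integral polyhedron and the Rees algebra $R[It]$ is a normal domain.
   Context: $K$ is a field, $R=K[x_1,\ldots,x_n]$. A clutter $\mathcal{C}$ with vertex set $X=\{x_1,\ldots,x_n\}$ is a family of subsets $S_1,\ldots,S_q$ of $X$, called edges, none of which is included in another; here $q\ge 1$ and the edges are nonempty. Its incidence matrix $A$ is the $n\times q$ $\{0,1\}$-matrix whose $j$th column $v_j$ is the characteristic vector of $S_j$. Its edge ideal $I=I(\mathcal{C})$ is the square-free monomial ideal of $R$ (minimally) generated by $x^{v_1},\ldots,x^{v_q}$, where $x^a=x_1^{a_1}\cdots x_n^{a_n}$, so that $x^{v_j}=\prod_{x_i\in S_j}x_i$. The Rees algebra of $I$ is $R[It]=R[x^{v_1}t,\ldots,x^{v_q}t]=R\oplus It\oplus I^2t^2\oplus\cdots\subset R[t]$, with $t$ a new variable; normal means integrally closed in its field of fractions. $\mathbf{1}$ denotes an all-ones vector, $\langle\,,\,\rangle$ the usual inner product, and vector inequalities are componentwise. The polyhedron $Q(A)$ is integral if all its vertices (extreme points) have integer coordinates. The clutter $\mathcal{C}$ has the max-flow min-cut (MFMC) property if both sides of the LP-duality equation $$\min\{\langle\alpha,x\rangle\mid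 x\ge 0;\ xA\ge\mathbf{1}\}=\max\{\langle y,\mathbf{1}\rangle\mid y\ge 0;\ Ay\le\alpha\}$$ have integral optimum solutions $x$ and $y$ for each non-negative integral vector $\alpha\in\mathbb{N}^n$. *)

(* Defs.v *)
From HB Require Import structures.
From mathcomp Require Import all_boot all_order all_algebra.
From mathcomp Require Import boolp classical_sets reals.
From mathcomp Require Import mpoly.

Set Implicit Arguments.
Unset Strict Implicit.
Unset Printing Implicit Defensive.

Import Order.TTheory GRing.Theory Num.Theory.

Local Open Scope ring_scope.
Local Open Scope classical_set_scope.

Record clutter (n q : nat) := Clutter {
  edge :> 'I_q -> {set 'I_n};
  clutter_gt0 : (0 < q)%N;
  clutter_edge_neq0 : forall j, edge j != finset.set0;
  clutter_antichain : forall j k, j != k -> ~~ (edge j \subset edge k) }.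

(* The ring of entries is a parameter: the reals for the linear programs,
   [nat] for the exponents of the monomials generating the edge ideal. *)
Definition incidence (S : pzSemiRingType) (n q : nat) (C : clutter n q) :
    'M[S]_(n, q) :=
  \matrix_(i < n, j < q) (i \in C j)%:R.

Definition mx_le (F : numDomainType) (m n : nat) (u v : 'M[F]_(m, n)) : Prop :=
  forall i j, u i j <= v i j.

Definition mx_integral (F : archiNumDomainType) (m n : nat) (u : 'M[F]_(m, n)) :
    Prop :=
  forall i j, u i j \is a Num.int.

Definition is_minimizer (F : numDomainType) (T : Type) (P : set T) (f : T -> F)
    (x : T) : Prop :=
  P x /\ forall y, P y -> f x <= f y.

Definition is_maximizer (F : numDomainType) (T : Type) (P : set T) (f : T -> F)
    (x : T) : Prop :=
  P x /\ forall y, P y -> f y <= f x.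

Definition polyQ (F : realType) (n q : nat) (A : 'M[F]_(n, q)) : set 'rV[F]_n :=
  [set x | mx_le 0 x /\ mx_le (const_mx 1) (x *m A)].

Definition extreme_point (F : realType) (n : nat) (P : set 'rV[F]_n)
    (x : 'rV[F]_n) : Prop :=
  P x /\
  forall (y z : 'rV[F]_n) (t : F), P y -> P z -> 0 < t -> t < 1 ->
    x = t *: y + (1 - t) *: z -> y = x /\ z = x.

Definition integral_polyhedron (F : realType) (n : nat) (P : set 'rV[F]_n) :
    Prop :=
  forall x, extreme_point P x -> mx_integral x.

Definition packing (F : realType) (n q : nat) (A : 'M[F]_(n, q))
    (alpha : 'cV[F]_n) : set 'cV[F]_q :=
  [set y | mx_le 0 y /\ mx_le (A *m y) alpha].

(* The optimum solutions range over real vectors: an integral optimum solution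
   is an integral vector optimal among all real feasible ones.  The equality of
   the two optimal values is LP duality, hence not part of the definition. *)
Definition mfmc (F : realType) (n q : nat) (C : clutter n q) : Prop :=
  let A := incidence F C in
  forall alpha : 'cV[nat]_n,
    let alphaF : 'cV[F]_n := map_mx (fun k : nat => k%:R) alpha in
    (exists x : 'rV[F]_n, mx_integral x /\
       is_minimizer (polyQ A) (fun x => \sum_(i < n) alphaF i 0 * x 0 i) x) /\
    (exists y : 'cV[F]_q, mx_integral y /\
       is_maximizer (packing A alphaF) (fun y => \sum_(j < q) y j 0) y).

Definition edge_monomial (n q : nat) (C : clutter n q) (j : 'I_q) :
    'X_{1.. n} :=
  [multinom incidence nat C i j | i < n].

Definition edge_ideal (K : fieldType) (n q : nat) (C : clutter n q) :
    set {mpoly K[n]} :=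
  [set f | exists c : 'I_q -> {mpoly K[n]},
             f = \sum_(j < q) c j * 'X_[edge_monomial C j]].
Arguments edge_ideal K {n q} C.

(* [rees_mem I] is the subring [D[It]] of [D[t]] generated by [D] and [It],
   with ['X : {poly D}] as the variable [t]. *)
Inductive rees_mem (D : idomainType) (I : set D) : {poly D} -> Prop :=
| rees_const (a : D) : rees_mem I a%:P
| rees_gen (f : D) : I f -> rees_mem I (f *: 'X)
| rees_add (p q : {poly D}) : rees_mem I p -> rees_mem I q -> rees_mem I (p + q)
| rees_mul (p q : {poly D}) : rees_mem I p -> rees_mem I q -> rees_mem I (p * q).

Definition rees_pred (D : idomainType) (I : set D) : {pred {poly D}} :=
  fun p => `[< rees_mem I p >].

(* In MathComp the inverse of a non-unit is itself and the units of [D[t]] are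
   units of [D], so the subring [D[It]] is closed under this total inverse. *)
Lemma rees_divring_closed (D : idomainType) (I : set D) :
  divring_closed (rees_pred I).
Proof.
have opp p : rees_mem I p -> rees_mem I (- p).
  by move=> Ip; rewrite -mulN1r -polyCN; apply: rees_mul => //; exact: rees_const.
split=> [|p q /asboolP Ip /asboolP Iq|p q /asboolP Ip /asboolP Iq]; apply/asboolP.
- by rewrite -polyC1; exact: rees_const.
- by apply: rees_add => //; exact: opp.
- apply: rees_mul => //.
  have [uq|nuq] := boolP (q \is a GRing.unit); last by rewrite invr_out.
  have := uq; rewrite poly_unitE => /andP[/size_poly1P[c _ def_q]].
  rewrite {q Iq}def_q in uq *; rewrite coefC eqxx => uc.
  suff -> : c%:P^-1 = (c^-1)%:P by exact: rees_const.
  by apply: (mulrI uq); rewrite divrr // -polyCM divrr.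
Qed.

HB.instance Definition _ (D : idomainType) (I : set D) :=
  GRing.isDivringClosed.Build {poly D} (rees_pred I) (rees_divring_closed I).

Record rees_algebra (D : idomainType) (I : set D) := ReesAlgebra {
  rees_val : {poly D};
  rees_valP : rees_val \in rees_pred I }.

Section ReesAlgebraInstances.
Variables (D : idomainType) (I : set D).

HB.instance Definition _ := [isSub of rees_algebra I for @rees_val D I].
HB.instance Definition _ := [Choice of rees_algebra I by <:].
HB.instance Definition _ :=
  [SubChoice_isSubIntegralDomain of rees_algebra I by <:].

End ReesAlgebraInstances.

Definition normal_domain (D : idomainType) : Prop :=
  forall z : {fraction D},
    integralOver (@tofrac D) z -> exists a : D, z = tofrac a.

(* Main.v *)
(** The Rees algebra is spanned by the monomials [x^m t^b] such that [m] admits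
   an integral packing of [b] edges, so everything reduces to the saturation of
   this set of pairs [(m, b)].

   MFMC implies integrality: the sum [alpha] of the normals of the constraints
   tight at a vertex is a natural vector, and any minimizer for [alpha] is tight
   where the vertex is, hence equal to it.

   MFMC implies normality: an integral element [z = f / g] is almost integral,
   [c z^k] being in [R[It]] for all [k].  Comparing leading monomials,
   [lm c + k (lm f - lm g)] is packable for all [k]; after scaling,
   [lm f - lm g] has real packings of value close to the required one, hence an
   integral one by MFMC.  So the leading term of [f] can be cancelled by a multiple of [g],
   and well-founded induction on the leading monomial applies.

   Conversely let [b] be the least value of an integral cover for [alpha].  By
   Farkas' lemma over the rationals either [alpha] has a rational packing of
   value [b], or some point of [Q(A)], hence some vertex, is cheaper than [b];
   the latter contradicts integrality.  A multiple of the rational packing is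
   integral, so a power of [x^alpha t^b] is in [R[It]], and normality
   provides an integral packing of value [b]; weak duality concludes. *)

Require Import Defs.
From HB Require Import structures.
From mathcomp Require Import all_boot all_order all_algebra.
From mathcomp Require Import boolp classical_sets reals.
From mathcomp Require Import mpoly.
From mathcomp Require Import ring lra zify.

Set Implicit Arguments.
Unset Strict Implicit.
Unset Printing Implicit Defensive.

Import Order.TTheory GRing.Theory Num.Theory.
Local Open Scope ring_scope.

(** * Linear inequalities *)

(** Serves to back-substitute the eliminated variable in Fourier-Motzkin elimination. *)
Lemma exists_between (F : realFieldType) (s1 s2 : seq F) :
  (forall l u, l \in s1 -> u \in s2 -> l <= u) ->
  exists x, (forall l, l \in s1 -> l <= x) /\ (forall u, u \in s2 -> x <= u).
Proof.
elim: s1 => [_|l s1 IH le12].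
  elim: s2 => [|u s2 [x [_ xle]]]; first by exists 0.
  exists (Num.min u x); split=> // v; rewrite inE => /predU1P[->|/xle].
    by rewrite ge_min lexx.
  by rewrite ge_min => ->; rewrite orbT.
have [|x [lex xle]] := IH.
  by move=> k u ks us; apply: le12; rewrite ?inE ?ks ?orbT.
exists (Num.max l x); split=> [k|u us].
  rewrite inE => /predU1P[->|/lex]; first by rewrite le_max lexx.
  by rewrite le_max => ->; rewrite orbT.
by rewrite ge_max xle // le12 ?inE ?eqxx.
Qed.

(** Fourier-Motzkin elimination: nonnegative combinations of rows remove the first variable, and a
    certificate for the new system composes with them into one for the old. *)
Lemma farkas (F : realFieldType) (n : nat) (I : finType)
    (a : I -> 'I_n -> F) (b : I -> F) :
  (exists x : 'I_n -> F, forall i, \sum_k a i k * x k <= b i) \/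
  (exists u : I -> F, [/\ forall i, 0 <= u i,
     forall k, \sum_i u i * a i k = 0 & \sum_i u i * b i < 0]).
Proof.
elim: n I a b => [|n IH] I a b.
  have [/forallP b_ge0|/forallPn[i bi_lt0]] := boolP [forall i, 0 <= b i].
    by left; exists (fun=> 0) => i; rewrite big_ord0.
  right; exists (fun j => (j == i)%:R); split=> [j||].
  - exact: ler0n.
  - by case.
  - rewrite (bigD1 i) //= eqxx mul1r big1 ?addr0 ?ltNge // => j /negPf ->.
    by rewrite mul0r.
(* Row [inl i0] keeps an inequality free of the first variable, row [inr (p, m)] cancels it between
   rows of opposite signs; other indices get weight zero, that is the row 0 <= 0. *)
pose elim_w (j : I + I * I) (i : I) : F :=
  match j with
  | inl i0 => ((i == i0) && (a i0 ord0 == 0))%:R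
  | inr (p, m) => if (0 < a p ord0) && (a m ord0 < 0) then
                    a p ord0 * (i == m)%:R - a m ord0 * (i == p)%:R
                  else 0
  end.
have w_ge0 j i : 0 <= elim_w j i.
  case: j => [i0|[p m]] /=; first exact: ler0n.
  case: ifP => // /andP[/ltW ap /ltW am].
  by rewrite addr_ge0 ?mulr_ge0 // -mulNr mulr_ge0 // oppr_ge0.
have sum_delta (i0 : I) (h : I -> F) : \sum_i (i == i0)%:R * h i = h i0.
  rewrite (bigD1 i0) //= eqxx mul1r big1 ?addr0 // => j /negPf ->.
  by rewrite mul0r.
have sum_inr p m (h : I -> F) : 0 < a p ord0 -> a m ord0 < 0 ->
    \sum_i elim_w (inr (p, m)) i * h i = a p ord0 * h m - a m ord0 * h p.
  move=> ap am; rewrite /= ap am /= -(sum_delta m h) -(sum_delta p h).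
  rewrite !mulr_sumr -sumrB; apply: eq_bigr => i _.
  by rewrite mulrBl !mulrA.
have sum_inl i0 (h : I -> F) : a i0 ord0 = 0 ->
    \sum_i elim_w (inl i0) i * h i = h i0.
  move=> ai0; rewrite -(sum_delta i0 h); apply: eq_bigr => i _ /=.
  by rewrite ai0 eqxx andbT.
have w_elim j : \sum_i elim_w j i * a i ord0 = 0.
  case: j => [i0|[p m]].
    have [ai0|ai0] := eqVneq (a i0 ord0) 0; first by rewrite sum_inl.
    by rewrite big1 // => i _; rewrite /= (negPf ai0) andbF mul0r.
  have [/andP[ap am]|npm] := boolP ((0 < a p ord0) && (a m ord0 < 0)).
    by rewrite sum_inr // mulrC subrr.
  by rewrite big1 // => i _; rewrite /= (negPf npm) mul0r.
have [[x xP]|[u [u_ge0 ua ub]]] := IH _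
  (fun j k => \sum_i elim_w j i * a i (lift ord0 k))
  (fun j => \sum_i elim_w j i * b i); last first.
  right; exists (fun i => \sum_j u j * elim_w j i); split=> [i|k|].
  - by apply: sumr_ge0 => j _; apply: mulr_ge0.
  - under eq_bigr do rewrite mulr_suml.
    rewrite exchange_big /=.
    case: (unliftP ord0 k) => [k' ->|->].
      rewrite -[RHS](ua k'); apply: eq_bigr => j _.
      by rewrite mulr_sumr; apply: eq_bigr => i _; rewrite mulrA.
    rewrite big1 // => j _.
    by under eq_bigr do rewrite -mulrA; rewrite -mulr_sumr w_elim mulr0.
  - under eq_bigr do rewrite mulr_suml.
    rewrite exchange_big /=; congr (_ < 0): ub; apply: eq_bigr => j _.
    by rewrite mulr_sumr; apply: eq_bigr => i _; rewrite mulrA.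
left; pose r i := \sum_k a i (lift ord0 k) * x k.
have rowE j : \sum_k (\sum_i elim_w j i * a i (lift ord0 k)) * x k =
    \sum_i elim_w j i * r i.
  under eq_bigr do rewrite mulr_suml.
  rewrite exchange_big /=; apply: eq_bigr => i _; rewrite mulr_sumr.
  by apply: eq_bigr => k _; rewrite mulrA.
(* The limit that row i puts on the first variable, lower or upper by the sign of its coefficient;
   the rows [inr (p, m)] make these limits compatible. *)
pose bound i := (b i - r i) / a i ord0.
have [|x0 [lex0 x0le]] := @exists_between F
    [seq bound m | m <- enum I & a m ord0 < 0]
    [seq bound p | p <- enum I & 0 < a p ord0].
  move=> l u /mapP[m]; rewrite mem_filter => /andP[am _] ->.
  move=> /mapP[p]; rewrite mem_filter => /andP[ap _] ->.
  have := xP (inr (p, m)); rewrite rowE !sum_inr // => le_pm.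
  rewrite /bound ler_pdivlMr // mulrAC ler_ndivrMr //; lra.
exists (fun k => oapp x x0 (unlift ord0 k)) => i.
rewrite big_ord_recl unlift_none /=.
under eq_bigr do rewrite liftK /=.
rewrite -/(r i) -lerBrDr.
case: (ltgtP (a i ord0) 0) => [ai|ai|ai].
- rewrite mulrC -ler_ndivrMr //; apply: lex0; apply/mapP; exists i => //.
  by rewrite mem_filter ai mem_enum.
- rewrite mulrC -ler_pdivlMr //; apply: x0le; apply/mapP; exists i => //.
  by rewrite mem_filter ai mem_enum.
- rewrite ai mul0r subr_ge0; have := xP (inl i).
  by rewrite rowE !sum_inl.
Qed.

Lemma exists_small_step (F : realFieldType) (I : finType) (s g : I -> F) :
  (forall i, 0 <= s i) -> (forall i, s i = 0 -> g i = 0) ->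
  exists2 e, 0 < e & forall i, 0 <= s i + e * g i.
Proof.
(* Each term bounds its own ratio; those with [s i = 0] vanish, as division by zero gives zero. *)
move=> s_ge0 sg0; pose N := 1 + \sum_i `|g i| / s i.
have sum_ge0 : 0 <= \sum_i `|g i| / s i.
  by apply: sumr_ge0 => i _; rewrite divr_ge0.
have N_gt0 : 0 < N by rewrite ltr_pwDl.
exists N^-1 => [|i]; first by rewrite invr_gt0.
have [si0|si_neq0] := eqVneq (s i) 0; first by rewrite sg0 // si0 mulr0 addr0.
have si_gt0 : 0 < s i by rewrite lt0r si_neq0 s_ge0.
suff le_gs : N^-1 * `|g i| <= s i.
  have : N^-1 * - `|g i| <= N^-1 * g i.
    by rewrite ler_pM2l ?invr_gt0 // lerNl -normrN ler_norm.
  rewrite mulrN; lra.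
rewrite mulrC ler_pdivrMr // -ler_pdivrMl // mulrC /N (bigD1 i) //=.
rewrite addrCA lerDl addr_ge0 // sumr_ge0 // => j _; exact: divr_ge0.
Qed.

(** * Vertices of the covering polyhedron *)

Section CoveringPolyhedron.
Variables (F : realType) (n q : nat) (A : 'M[F]_(n, q)).
Implicit Types x d : 'rV[F]_n.

Definition slack_dir d (i : 'I_n + 'I_q) : F :=
  match i with inl k => d 0 k | inr j => (d *m A) 0 j end.

Definition slack x (i : 'I_n + 'I_q) : F :=
  slack_dir x i - (if i is inr _ then 1 else 0).

Lemma polyQP x : polyQ A x <-> forall i, 0 <= slack x i.
Proof.
split=> [[x0 xA] [k|j]|s_ge0].
- by have := x0 0 k; rewrite mxE /slack /= subr0.
- by have := xA 0 j; rewrite mxE /slack /= subr_ge0.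
split=> [i k|i j]; rewrite mxE (ord1 i).
  by have := s_ge0 (inl k); rewrite /slack /= subr0.
by have := s_ge0 (inr j); rewrite /slack /= subr_ge0.
Qed.

Lemma slack_dirD x d i : slack_dir (x + d) i = slack_dir x i + slack_dir d i.
Proof. by case: i => [k|j] /=; rewrite ?mulmxDl mxE. Qed.

Lemma slack_dirZ t d i : slack_dir (t *: d) i = t * slack_dir d i.
Proof. by case: i => [k|j] /=; rewrite -?scalemxAl mxE. Qed.

Lemma slackD x t d i : slack (x + t *: d) i = slack x i + t * slack_dir d i.
Proof. by rewrite /slack slack_dirD slack_dirZ addrAC. Qed.

Lemma slackB x y i : slack x i - slack y i = slack_dir (x - y) i.
Proof. by rewrite /slack slack_dirD -scaleN1r slack_dirZ; ring. Qed.

(** Otherwise the segment from w to x could be prolonged beyond x inside Q(A): constraints tight at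
    x stay tight along it, the others leave room for a small step. *)
Lemma extreme_pointP x w : extreme_point (polyQ A) x -> polyQ A w ->
  (forall i, slack x i = 0 -> slack w i = 0) -> w = x.
Proof.
move=> [Qx extr] Qw tight.
have [||e e_gt0 step] := @exists_small_step F _ (slack x) (slack_dir (x - w)).
- exact/polyQP.
- by move=> i si0; rewrite -slackB si0 tight // subrr.
have e1_gt0 : 0 < 1 + e by rewrite addr_gt0.
(* The weight t solves x = t w + (1 - t)(x + e (x - w)). *)
have [] // := extr w (x + e *: (x - w)) (e / (1 + e)) Qw.
- by apply/polyQP => i; rewrite slackD.
- by rewrite divr_gt0.
- by rewrite ltr_pdivrMr // mul1r ltrDr.
apply/rowP => k; rewrite !mxE; field; lra.
Qed.

(* Among the feasible points no more expensive than [x], one with the most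
   tight constraints is a vertex: otherwise one could move along a segment
   through it, in the direction which does not increase the cost, until a new
   constraint becomes tight. *)
Lemma exists_vertex_le (c : 'I_n -> F) x : (forall k, 0 <= c k) -> polyQ A x ->
  exists2 v, extreme_point (polyQ A) v &
    \sum_k c k * v 0 k <= \sum_k c k * x 0 k.
Proof.
move=> c_ge0; pose cost x : F := \sum_k c k * x 0 k.
have costD y t d : cost (y + t *: d) = cost y + t * cost d.
  rewrite /cost mulr_sumr -big_split /=; apply: eq_bigr => k _.
  by rewrite !mxE; ring.
have costN d : cost (- d) = - cost d.
  by rewrite /cost -sumrN; apply: eq_bigr => k _; rewrite mxE mulrN.
pose slk x := #|[pred i | slack x i != 0]|.
have [m] := ubnP (slk x); elim: m x => // m IH x lt_m Qx.
have [extr|nextr] := pselect (extreme_point (polyQ A) x); first by exists x.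
(* The negative coordinate guarantees that the ray along d leaves Q(A). *)
suff [d [cd_le0 [k dk_lt0] tight]] : exists d, [/\ cost d <= 0,
    exists k, d 0 k < 0 & forall i, slack x i = 0 -> slack_dir d i = 0].
  (* Ratio test: e is the longest step that stays in Q(A), and [i0] becomes tight after it. *)
  case: (arg_minP (fun i => slack x i / - slack_dir d i)
          (P := fun i => slack_dir d i < 0) (i0 := inl k)) => // i0 di0 i0_min.
  set e := slack x i0 / - slack_dir d i0 in i0_min.
  have s_ge0 := (polyQP x).1 Qx.
  have e_ge0 : 0 <= e by rewrite divr_ge0 // oppr_ge0 ltW.
  have Qx' : polyQ A (x + e *: d).
    apply/polyQP => i; rewrite slackD.
    have [di|di] := ltP (slack_dir d i) 0; last first.
      by apply: addr_ge0 => //; apply: mulr_ge0.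
    by have := i0_min i di; rewrite ler_pdivlMr ?oppr_gt0 //; lra.
  have [|v v_extr v_le] := IH (x + e *: d) _ Qx'.
    rewrite ltnS in lt_m; apply: leq_trans lt_m.
    apply/proper_card/properP; split.
      apply/fintype.subsetP => i; rewrite !inE slackD; apply: contraNneq => si0.
      by rewrite si0 tight // mulr0 addr0.
    exists i0; rewrite inE ?slackD.
      by apply: contraTneq di0 => /tight ->; rewrite ltxx.
    by rewrite negbK /e invrN mulrN mulNr divfK ?subrr // lt_eqF.
  exists v => //; apply: le_trans v_le _; rewrite -/(cost _) costD gerDl.
  exact: mulr_ge0_le0.
have [y [z [t [Qy Qz t_gt0 t_lt1 [xE y_neq]]]]] : exists y z t,
    [/\ polyQ A y, polyQ A z, 0 < t, t < 1 &
      x = t *: y + (1 - t) *: z /\ y != x].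
  apply: contrapT => nyz; apply: nextr; split=> // y z t Qy Qz t0 t1 xE.
  have yx : y = x.
    apply: contrapT => /eqP nyx; apply: nyz; exists y, z, t; by split.
  split=> //; have t1' : 1 - t != 0 by rewrite subr_eq0 gt_eqF.
  apply: (scalerI t1'); move: xE; rewrite yx {1}(_ : x = t *: x + (1 - t) *: x).
    by move/addrI.
  by rewrite -scalerDl addrC subrK scale1r.
pose d := y - x.
(* A slack vanishing at x is a proper convex combination of nonnegative slacks at y and z. *)
have d_tight i : slack x i = 0 -> slack_dir d i = 0.
  move=> si0; have dy : slack_dir d i = slack y i by rewrite -slackB si0 subr0.
  have := (polyQP y).1 Qy i; have := (polyQP z).1 Qz i.
  have : slack x i = t * slack y i + (1 - t) * slack z i.
    by rewrite {1}xE /slack slack_dirD !slack_dirZ; ring.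
  rewrite si0 dy => avg z_ge0 y_ge0; nra.
have cost_lt0 e : cost e < 0 -> exists k, e 0 k < 0.
  move=> e_lt0; apply: contrapT => ne; move: e_lt0; apply/negP.
  rewrite -leNgt; apply: sumr_ge0 => k _; apply: mulr_ge0 => //.
  by rewrite leNgt; apply/negP => ek; apply: ne; exists k.
have dN_tight i : slack x i = 0 -> slack_dir (- d) i = 0.
  by move=> /d_tight di; rewrite -scaleN1r slack_dirZ di mulr0.
(* One of d and -d does not raise the cost; at cost zero the sign is chosen to make a nonzero
   coordinate negative. *)
case: (ltgtP (cost d) 0) => [cd|cd|cd].
- by exists d; split=> //; [exact: ltW|exact: cost_lt0].
- exists (- d); split=> //; first by rewrite costN oppr_le0 ltW.
  by apply: cost_lt0; rewrite costN oppr_lt0.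
have /existsP[k dk] : [exists k, d 0 k != 0].
  apply: contraNT y_neq => /existsPn dk; rewrite -subr_eq0 -/d; apply/eqP/rowP.
  by move=> k; have := dk k; rewrite negbK [RHS]mxE => /eqP.
case: (ltgtP (d 0 k) 0) dk => // dk _.
  by exists d; split; [rewrite cd|exists k|].
exists (- d); split; [by rewrite costN cd oppr0| |by []].
by exists k; rewrite mxE oppr_lt0.
Qed.

End CoveringPolyhedron.

(** * Integral vertices from the MFMC property *)

Lemma mfmc_integral (F : realType) (n q : nat) (C : clutter n q) :
  mfmc F C -> integral_polyhedron (polyQ (incidence F C)).
Proof.
move=> mC x extr; set A := incidence F C in extr.
pose tight i := slack A x i == 0.
pose alpha : 'cV[nat]_n :=
  \col_k (tight (inl k) + \sum_(j | tight (inr j)) (k \in C j))%N.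
have [[w [w_int [Qw w_min]]] _] := mC alpha.
suff <- : w = x by [].
apply: (extreme_pointP extr Qw) => i0 si0.
(* So cost and total slack over the constraints tight at x differ by a constant, and the minimizer w
   has total tight slack at most that of x, which is zero. *)
have costE (y : 'rV[F]_n) :
    \sum_k (map_mx (fun k => k%:R) alpha : 'cV[F]_n) k 0 * y 0 k =
    \sum_(i | tight i) slack_dir A y i.
  rewrite big_sumType /=.
  under eq_bigr do rewrite !mxE natrD mulrDl.
  rewrite big_split /=; congr (_ + _).
    rewrite [RHS]big_mkcond /=; apply: eq_bigr => k _.
    by case: ifP; rewrite ?mul1r ?mul0r.
  under eq_bigr do rewrite natr_sum mulr_suml.
  rewrite exchange_big /=; apply: eq_bigr => j _; rewrite mxE.
  by apply: eq_bigr => k _; rewrite !mxE mulrC.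
have := w_min x extr.1; rewrite !costE -subr_le0 -sumrB.
rewrite (eq_bigr (slack A w)) => [sum_le0|i /eqP si].
  have w_ge0 := (polyQP A w).1 Qw.
  have /eqP : \sum_(i | tight i) slack A w i = 0.
    by apply: le_anti; rewrite sum_le0 sumr_ge0.
  rewrite psumr_eq0 // => /allP/(_ i0); rewrite mem_index_enum /tight si0 eqxx.
  by move=> /(_ isT) /eqP.
have -> : slack_dir A w i - slack_dir A x i = slack A w i - slack A x i.
  by rewrite /slack; ring.
by rewrite si subr0.
Qed.

(** * Fractions and integrality *)

Lemma frac_div (D : idomainType) (z : {fraction D}) :
  exists f g : D, g != 0 /\ z = tofrac f / tofrac g.
Proof.
elim/quotW: z => x; have dx0 := denom_ratioP x.
exists (frac x).1, (frac x).2; split=> //.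
have tdx0 : tofrac (frac x).2 != 0 by rewrite tofrac_eq0.
apply: (mulIf tdx0); rewrite divfK //.
unlock tofrac; rewrite -[LHS]FracField.pi_mul; apply/eqmodP.
rewrite /= FracField.equivfE /FracField.mulf.
rewrite !numden_Ratio ?mulf_neq0 ?oner_neq0 //.
by rewrite !mulr1 mulrC.
Qed.

(** If m is the degree of a monic equation of z = f / g, then g^m clears the denominator of z^k:
    directly for k <= m, and by lowering the exponent with the equation beyond. *)
Lemma integral_almost_integral (D : idomainType) (f g : D) : g != 0 ->
  integralOver (@tofrac D) (tofrac f / tofrac g) ->
  exists2 c, c != 0 & forall k, exists u, c * f ^+ k = u * g ^+ k.
Proof.
move=> g0 [p p_mon /rootP pz]; set z := _ / _ in pz.
have tg0 : tofrac g != 0.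
  by rewrite tofrac_eq0.
pose m := (size p).-1; exists (g ^+ m); first exact: expf_neq0.
suff im k : exists u, tofrac (g ^+ m) * z ^+ k = tofrac u.
  move=> k; have [u zk] := im k; exists u; apply/eqP.
  rewrite -tofrac_eq !tofracM -zk !tofracXn /z expr_div_n -mulrA divfK //.
  exact: expf_neq0.
have [s] := ubnP k; elim: s k => // s IH k; rewrite ltnS => le_ks.
have [le_km|/ltnW le_mk] := leqP k m.
  exists (g ^+ (m - k) * f ^+ k); rewrite -{1}(subnK le_km) exprD !tofracM.
  by rewrite -mulrA; congr (_ * _); rewrite !tofracXn -exprMn mulrC divfK.
have zm : z ^+ m = - \sum_(i < m) tofrac p`_i * z ^+ i.
  have p_gt0 : (0 < size p)%N by rewrite size_poly_gt0 monic_neq0.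
  move: pz; rewrite horner_coef size_map_poly_id0; last first.
    by rewrite (monicP p_mon) tofrac_eq0 oner_neq0.
  rewrite -(prednK p_gt0) big_ord_recr /=.
  have pE i : (map_poly (@tofrac D) p)`_i = tofrac p`_i by rewrite coef_map.
  rewrite !pE -/(lead_coef p) (monicP p_mon) tofrac1 mul1r -/m => /eqP.
  rewrite addrC addr_eq0 => /eqP ->; congr (- _); apply: eq_bigr => i _.
  by rewrite pE.
have /choice[u uP] (i : 'I_m) :
    exists u, tofrac (g ^+ m) * z ^+ (k - m + i) = tofrac u.
  by apply: IH; have := ltn_ord i; lia.
exists (- \sum_(i < m) p`_i * u i).
rewrite -(subnK le_mk) exprD zm tofracN rmorph_sum /= !mulrN; congr (- _).
rewrite !mulr_sumr; apply: eq_bigr => i _.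
by rewrite tofracM -uP exprD; ring.
Qed.

(** The fraction f / g is a root of X^p - c. *)
Lemma normal_dvd_exp (D : idomainType) (f g c : D) p : normal_domain D ->
  (0 < p)%N -> g != 0 -> f ^+ p = c * g ^+ p -> exists a, f = a * g.
Proof.
move=> normal p_gt0 g0 fp; have tg0 : tofrac g != 0 by rewrite tofrac_eq0.
have [|a zE] := normal (tofrac f / tofrac g).
  exists ('X^p - c%:P); first exact: monicXnsubC.
  rewrite /root rmorphB /= map_polyXn map_polyC /= !hornerE.
  by rewrite expr_div_n -tofracXn fp tofracM tofracXn mulfK ?expf_neq0 ?subrr.
by exists a; apply/eqP; rewrite -tofrac_eq tofracM -zE divfK.
Qed.

Lemma pred_size_mul (D : idomainType) (f g : {poly D}) : f != 0 -> g != 0 ->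
  (size (f * g)).-1 = ((size f).-1 + (size g).-1)%N.
Proof.
move=> f0 g0; rewrite size_mul //.
move: f0 g0; rewrite -!size_poly_gt0.
by case: (size f) (size g) => [|k] [|l] //=; rewrite addnS.
Qed.

(** * Packings and the Rees algebra *)

Section Packings.
Variables (n q : nat) (C : clutter n q).
Implicit Types (m : 'X_{1.. n}) (b : nat).

(** Equivalently, x^m lies in I^b. *)
Definition packs m b : Prop := exists y : 'I_q -> nat,
  (b <= \sum_j y j)%N /\ forall i, (\sum_j y j * (i \in C j) <= m i)%N.

Lemma packs0 m : packs m 0.
Proof. by exists (fun=> 0%N); split=> // i; rewrite big1. Qed.

Lemma packsD m1 m2 b1 b2 :
  packs m1 b1 -> packs m2 b2 -> packs (m1 + m2)%MM (b1 + b2)%N.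
Proof.
move=> [y1 [b1_le y1_le]] [y2 [b2_le y2_le]].
exists (fun j => (y1 j + y2 j)%N); split=> [|i].
  by rewrite big_split leq_add.
by under eq_bigr do rewrite mulnDl; rewrite big_split mnmDE leq_add.
Qed.

Lemma edge_monomialE j i : edge_monomial C j i = (i \in C j).
Proof. by rewrite mnmE mxE natn. Qed.

Lemma packs1 m j : (edge_monomial C j <= m)%MM -> packs m 1.
Proof.
move=> /mnm_lepP le_jm; exists (fun k => (k == j : nat)); split=> [|i].
  by rewrite (bigD1 j) //= eqxx.
rewrite (bigD1 j) //= eqxx mul1n big1 => [|k /negPf -> //].
by rewrite addn0 -edge_monomialE.
Qed.

Lemma packsS m b : packs m b.+1 ->
  exists2 j, (edge_monomial C j <= m)%MM & packs (m - edge_monomial C j)%MM b.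
Proof.
move=> [y [b_lt y_le]].
have /existsP[j yj] : [exists j, 0 < y j]%N.
  apply: contraLR b_lt => /existsPn y0; rewrite big1 // => j _.
  by have := y0 j; case: (y j).
(* The truncated subtraction is exact because [y j] is positive. *)
have sumE (h : 'I_q -> nat) :
    (\sum_k y k * h k = h j + \sum_k (y k - (k == j)) * h k)%N.
  rewrite (bigD1 j) //= [in RHS](bigD1 j) //= eqxx.
  under [in RHS]eq_bigr => k /negPf -> do rewrite subn0.
  by rewrite addnA -mulSn subn1 prednK.
have le_jm i : ((i \in C j) + \sum_k (y k - (k == j)) * (i \in C k) <= m i)%N.
  by rewrite -sumE.
exists j.
  apply/mnm_lepP => i; rewrite edge_monomialE.
  by rewrite (leq_trans _ (le_jm i)) ?leq_addr.
exists (fun k => (y k - (k == j))%N); split=> [|i]; last first.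
  by rewrite mnmBE edge_monomialE leq_subRL ?(leq_trans _ (le_jm i)) ?leq_addr.
move: (sumE (fun=> 1%N)) b_lt; rewrite add1n.
under eq_bigr do rewrite muln1.
by under [in RHS]eq_bigr do rewrite muln1; move=> ->.
Qed.

(** * Monomials of the Rees algebra *)

Section Rees.
Variable K : fieldType.
Local Notation R := {mpoly K[n]}.
Local Notation I := (edge_ideal K C).

Lemma rees_mem_sum (T : Type) (r : seq T) (P : pred T) (F : T -> {poly R}) :
  (forall i, P i -> rees_mem I (F i)) -> rees_mem I (\sum_(i <- r | P i) F i).
Proof.
move=> IF; apply: (big_ind (rees_mem I)) => //; last exact: rees_add.
by rewrite -polyC0; apply: rees_const.
Qed.

Lemma edge_ideal_gen j : I 'X_[edge_monomial C j].
Proof.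
exists (fun k => (k == j)%:R).
rewrite (bigD1 j) //= eqxx mul1r big1 ?addr0 // => k /negPf ->.
by rewrite mul0r.
Qed.

Lemma packs_rees m b : packs m b -> rees_mem I ('X_[m] *: 'X^b).
Proof.
elim: b m => [m _|b IH m /packsS[j le_jm /IH Ib]].
  by rewrite expr0 alg_polyC; apply: rees_const.
rewrite -(submK le_jm) mpolyXD -mul_polyC polyCM exprSr mulrACA !mul_polyC.
apply: rees_mul => //.
exact/rees_gen/edge_ideal_gen.
Qed.

(** The condition on the right holds for the generators and is stable under sums and, by [packsD],
    products; conversely each term of f lies in R[It] by [packs_rees]. *)
Lemma rees_memP (f : {poly R}) :
  rees_mem I f <-> forall b m, m \in msupp f`_b -> packs m b.
Proof.
split=> [|supp_f]; last first.
  rewrite -[f]coefK poly_def; apply: rees_mem_sum => b _.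
  rewrite (mpolyE f`_b) scaler_suml big_seq; apply: rees_mem_sum => m m_f.
  rewrite -mul_mpolyC -scalerA -mul_polyC; apply: rees_mul.
    exact: rees_const.
  exact/packs_rees/supp_f.
elim=> {f} [a|f [c ->]|f g _ If _ Ig|f g _ If _ Ig] b m.
- rewrite coefC; case: ifP => [/eqP-> _|_]; first exact: packs0.
  by rewrite msupp0.
- rewrite coefZ coefX; case: eqP => [->|_]; last by rewrite mulr0 msupp0.
  rewrite mulr1 => /msupp_sum_le /flatten_mapP[j _].
  rewrite (perm_mem (msuppMX _ _)) => /mapP[m' _ ->].
  by apply: (@packs1 _ j); exact: lem_addr.
- by rewrite coefD => /msuppD_le; rewrite mem_cat => /orP[/If|/Ig].
- rewrite coefM => /msupp_sum_le /flatten_mapP[i _] /msuppM_le.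
  move=> /allpairsP[[m1 m2] /= [/If m1P /Ig m2P ->]].
  rewrite -(@subnKC i b) -1?ltnS //; exact: packsD.
Qed.

(** * Division by leading terms *)

Implicit Types f g c h : {poly R}.

(** Complete integral closedness of the monoid of packable pairs, among pairs of natural
    exponents. *)
Definition packs_saturated : Prop := forall (m0 m : 'X_{1.. n}) (b0 b : nat),
  (forall k, packs (m0 + m *+ k)%MM (b0 + b * k)%N) -> packs m b.

(** The leading term is taken for the order that compares degrees in t first; its exponent of t is
    [(size f).-1]. *)
Definition lead_mnm (f : {poly R}) : 'X_{1.. n} := mlead (lead_coef f).

Lemma lead_mnmM f g : f != 0 -> g != 0 ->
  lead_mnm (f * g) = (lead_mnm f + lead_mnm g)%MM.
Proof.
by move=> f0 g0; rewrite /lead_mnm lead_coefM mleadM // lead_coef_eq0.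
Qed.

Lemma lead_mnmX f k : f != 0 -> lead_mnm (f ^+ k) = (lead_mnm f *+ k)%MM.
Proof.
by move=> f0; rewrite /lead_mnm lead_coef_exp mleadX // lead_coef_eq0.
Qed.

Lemma rees_lead_packs f : rees_mem I f -> f != 0 ->
  packs (lead_mnm f) (size f).-1.
Proof.
by move=> /rees_memP If f0; apply: If; apply: mlead_supp; rewrite lead_coef_eq0.
Qed.

(* The leading monomials of [c f^k = u g^k] give
   [lm c + k (lm f - lm g) = lm u] for all [k]. *)
Lemma lead_division f g c : packs_saturated -> f != 0 -> g != 0 -> c != 0 ->
  (forall k, exists2 u, rees_mem I u & c * f ^+ k = u * g ^+ k) ->
  [/\ (lead_mnm g <= lead_mnm f)%MM, (size g <= size f)%N &
      packs (lead_mnm f - lead_mnm g)%MM (size f - size g)].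
Proof.
move=> sat f0 g0 c0 cfg.
have := (f0, g0, c0); rewrite -!size_poly_gt0 => -[[sf sg] sc].
have lead k : exists m b, [/\ packs m b,
    (lead_mnm c + lead_mnm f *+ k = m + lead_mnm g *+ k)%MM &
    ((size c).-1 + (size f).-1 * k = b + (size g).-1 * k)%N].
  have [u Iu cu] := cfg k.
  have u0 : u != 0.
    apply: contraNneq (mulf_neq0 c0 (expf_neq0 k f0)) => u0.
    by rewrite cu u0 mul0r.
  exists (lead_mnm u), (size u).-1; split; first exact: rees_lead_packs.
    by rewrite -!lead_mnmX // -!lead_mnmM ?expf_neq0 // cu.
  have := congr1 (fun p : {poly R} => (size p).-1) cu.
  by rewrite /= !pred_size_mul ?expf_neq0 // !size_exp.
have le_gf : (lead_mnm g <= lead_mnm f)%MM.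
  apply/mnm_lepP => i.
  (* For k larger than the exponent of c at i, a larger exponent in g than in f is impossible. *)
  have [m [b [_ /mnmP/(_ i) + _]]] := lead (lead_mnm c i).+1.
  rewrite !mnmDE !mulmnE; nia.
have le_gf' : (size g <= size f)%N.
  have [m [b [_ _]]] := lead (size c); nia.
split=> //; apply: (sat (lead_mnm c) _ (size c).-1) => k.
have [m [b [mb lm lb]]] := lead k.
suff [-> ->] : (lead_mnm c + (lead_mnm f - lead_mnm g) *+ k)%MM = m /\
    ((size c).-1 + (size f - size g) * k)%N = b by [].
split; last by nia.
apply/mnmP => i; have := (mnmP _ _).1 lm i; have := (mnm_lepP le_gf) i.
rewrite !mnmDE !mulmnE mnmBE; nia.
Qed.

(** The product p g has the same leading term as f, so the difference is smaller in the
    lexicographic order on degree in t and leading monomial. *)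
Lemma lead_cancel f g (m := (lead_mnm f - lead_mnm g)%MM)
    (b := (size f - size g)%N)
    (p := ((mleadc (lead_coef f) / mleadc (lead_coef g)) *: 'X_[m]) *: 'X^b)
    (f1 := f - p * g) :
  f != 0 -> g != 0 -> (lead_mnm g <= lead_mnm f)%MM -> (size g <= size f)%N ->
  (size f1 < size f)%N \/ size f1 = size f /\ (lead_mnm f1 < lead_mnm f)%O.
Proof.
move=> f0 g0 le_gf le_gf'.
have lf0 : lead_coef f != 0 by rewrite lead_coef_eq0.
have lg0 : lead_coef g != 0 by rewrite lead_coef_eq0.
pose a := mleadc (lead_coef f) / mleadc (lead_coef g).
have mg0 : mleadc (lead_coef g) != 0 by rewrite mleadc_eq0.
have a0 : a != 0 by rewrite mulf_neq0 ?invr_eq0 ?mleadc_eq0.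
have aX0 : a *: 'X_[m] != 0 :> R.
  by rewrite scaler_eq0 negb_or a0 -msupp_eq0 msuppX.
have p0 : p != 0.
  by rewrite /p -mul_polyC mulf_neq0 ?polyC_eq0 // expf_neq0 ?polyX_eq0.
have size_pg : size (p * g) = size f.
  rewrite size_mul // size_scale // size_polyXn /b; move: g0.
  rewrite -size_poly_gt0; move: (size g) (size f) le_gf' => *; lia.
have size_f1 : (size f1 <= size f)%N.
  by rewrite (leq_trans (size_polyD _ _)) // size_polyN size_pg maxnn.
(* If r vanishes the degree in t drops; otherwise r is the leading coefficient of [f1]. *)
pose r := lead_coef f - lead_coef (p * g).
have rE : f1`_(size f).-1 = r by rewrite coefB /r /lead_coef size_pg.
have [r0|r0] := eqVneq r 0.
  left; move: f0; rewrite -size_poly_gt0 => f_gt0.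
  rewrite -(prednK f_gt0) ltnS; apply/leq_sizeP => j.
  rewrite leq_eqVlt => /predU1P[<-|lt_j]; first by rewrite rE.
  by rewrite nth_default // (leq_trans size_f1) // -(prednK f_gt0).
right; have sz : size f1 = size f.
  apply/eqP; rewrite eqn_leq size_f1 leqNgt; apply: contraNN r0 => lt_f1.
  by rewrite -rE nth_default // -ltnS (ltn_predK lt_f1).
split=> //; rewrite /lead_mnm {1}/lead_coef sz rE.
have lpE : lead_coef (p * g) = (a *: 'X_[m]) * lead_coef g.
  by rewrite lead_coefM lead_coefZ lead_coefXn mulr1.
have lfE : mlead (lead_coef f) = (mlead (a *: 'X_[m]) + mlead (lead_coef g))%MM.
  by rewrite mleadZ // mleadXm submK.
rewrite lt_neqAle; apply/andP; split; last first.
  by rewrite (le_trans (mleadB_le _ _)) // lpE mleadM // -lfE joinxx.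
apply: contraNneq r0 => lr; rewrite -mleadc_eq0 lr mcoeffB lpE.
rewrite [in X in _ - X]lfE mleadcM mleadcZE mleadXm mcoeffX eqxx mulr1.
by rewrite divfK ?subrr.
Qed.

(** Division by g, by induction on [size f] and then on the leading monomial. *)
Lemma almost_integral_rees f g c : packs_saturated -> g != 0 -> c != 0 ->
  (forall k, exists2 u, rees_mem I u & c * f ^+ k = u * g ^+ k) ->
  exists2 h, rees_mem I h & f = h * g.
Proof.
move=> sat g0 c0; have [s] := ubnP (size f); elim: s f => // s IHs f.
have [M] : exists M, M = lead_mnm f by exists (lead_mnm f).
elim/(well_founded_ind (@ltom_wf n)): M f => M IHM f MdE lt_s cfg.
have [->|f0] := eqVneq f 0.
  by exists 0; rewrite ?mul0r // -polyC0; apply: rees_const.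
have [le_gf le_gf' mb] := lead_division sat f0 g0 c0 cfg.
have := lead_cancel f0 g0 le_gf le_gf'.
set p := _ *: 'X^_; set f1 := f - p * g => f1_lt.
have Ip : rees_mem I p.
  by rewrite /p -mul_mpolyC -scalerA -mul_polyC; apply: rees_mul;
    [exact: rees_const|exact: packs_rees].
suff [h Ih f1E] : exists2 h, rees_mem I h & f1 = h * g.
  exists (h + p); first exact: rees_add.
  by rewrite mulrDl -f1E subrK.
have cf1g k : exists2 u, rees_mem I u & c * f1 ^+ k = u * g ^+ k.
  have /choice[u uP] : forall i,
      exists u, rees_mem I u /\ c * f ^+ i = u * g ^+ i.
    by move=> i; have [u] := cfg i; exists u.
  have IN h : rees_mem I h -> rees_mem I (- h).
    move=> Ih; rewrite -mulN1r -polyCN.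
    by apply: rees_mul; [exact: rees_const|].
  have IX h i : rees_mem I h -> rees_mem I (h ^+ i).
    move=> Ih; elim: i => [|i IHi].
      by rewrite expr0 -polyC1; exact: rees_const.
    by rewrite exprS; apply: rees_mul.
  (* Binomial expansion of (f - p g)^k, each c f^(k - i) being replaced by its multiple of g^(k -
     i). *)
  exists (\sum_(i < k.+1) u (k - i)%N * (- p) ^+ i *+ 'C(k, i)).
    apply: rees_mem_sum => i _; rewrite -mulr_natr -polyC_natr.
    apply: rees_mul; last exact: rees_const.
    by apply: rees_mul; [case: (uP (k - i)%N)|apply/IX/IN].
  rewrite /f1 -mulNr exprDn mulr_sumr mulr_suml; apply: eq_bigr => i _.
  rewrite mulrnAr mulrnAl; congr (_ *+ _).
  have -> : g ^+ k = g ^+ (k - i) * g ^+ i by rewrite -exprD subnK // -ltnS.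
  by rewrite mulrA (uP _).2 exprMn mulrACA mulrA.
case: f1_lt => [lt_f1|[eq_f1 lt_f1]].
  by apply: IHs cf1g; apply: leq_trans lt_f1 _.
by apply: IHM cf1g => //; rewrite ?MdE // eq_f1.
Qed.

(** * Normality of the Rees algebra and packings *)

Local Notation Rees := (rees_algebra I).

Lemma rees_val_inj : injective (@rees_val R I).
Proof. exact: (@val_inj _ _ Rees). Qed.

Lemma rees_valM (a b : Rees) : rees_val (a * b) = rees_val a * rees_val b.
Proof. exact: (rmorphM (val : Rees -> {poly R})). Qed.

Lemma rees_valX (a : Rees) k : rees_val (a ^+ k) = rees_val a ^+ k.
Proof. exact: (rmorphXn (val : Rees -> {poly R})). Qed.

Lemma rees_val_eq0 (a : Rees) : (rees_val a == 0) = (a == 0).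
Proof.
by rewrite -(rmorph0 (val : Rees -> {poly R})); apply: (inj_eq rees_val_inj).
Qed.

Lemma rees_val_mem (a : Rees) : rees_mem I (rees_val a).
Proof. exact/asboolP/(rees_valP a). Qed.

Lemma ex_rees f : rees_mem I f -> exists a : Rees, rees_val a = f.
Proof. by move=> /asboolP If; exists (ReesAlgebra If). Qed.

Lemma saturated_normal : packs_saturated -> normal_domain Rees.
Proof.
move=> sat z; have [f [g [g0 ->]]] := frac_div z.
move=> /(integral_almost_integral g0)[c c0 cfg].
have [||||h Ih fE] :=
    @almost_integral_rees (rees_val f) (rees_val g) (rees_val c).
- exact: sat.
- by rewrite rees_val_eq0.
- by rewrite rees_val_eq0.
- move=> k; have [u cu] := cfg k.
  exists (rees_val u); first exact: rees_val_mem.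
  by rewrite -!rees_valX -!rees_valM cu.
have [a aE] := ex_rees Ih; exists a.
have -> : f = a * g by apply: rees_val_inj; rewrite rees_valM aE.
by rewrite tofracM mulfK // tofrac_eq0.
Qed.

(** To see x^m t^b as a fraction of R[It], multiply it by (x^v)^b for an edge monomial x^v: the
    numerator x^m (x^v t)^b is in R[It]. Normality applies since the p-th power of the fraction is
    in R[It]. *)
Lemma normal_packs m b p : normal_domain Rees -> (0 < p)%N ->
  packs (m *+ p)%MM (b * p) -> packs m b.
Proof.
move=> normal p_gt0 mp; pose j0 := Ordinal (clutter_gt0 C).
pose v := edge_monomial C j0.
have [c cE] := ex_rees (packs_rees mp).
have [g gE] : exists g : Rees, rees_val g = ('X_[v] ^+ b)%:P.
  exact/ex_rees/rees_const.
have [f fE] : exists f : Rees, rees_val f = ('X_[m] *: 'X^b) * ('X_[v] ^+ b)%:P.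
  apply: ex_rees; rewrite -mul_polyC -mulrA.
  apply: rees_mul; first exact: rees_const.
  rewrite rmorphXn -exprMn mulrC mul_polyC.
  elim: b {mp c cE g gE} => [|b IH].
    by rewrite expr0 -polyC1; exact: rees_const.
  by rewrite exprS; apply: rees_mul => //; apply/rees_gen/edge_ideal_gen.
have g0 : g != 0.
  by rewrite -rees_val_eq0 gE polyC_eq0 expf_neq0 // -msupp_eq0 msuppX.
have fp : f ^+ p = c * g ^+ p.
  apply: rees_val_inj; rewrite rees_valM !rees_valX fE gE cE exprMn.
  congr (_ * _).
  by rewrite -!mul_polyC exprMn -exprM -rmorphXn /= mpolyXn.
have [a /(congr1 (@rees_val _ _))] := normal_dvd_exp normal p_gt0 g0 fp.
rewrite rees_valM fE gE => /mulIf aE.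
have : rees_mem I ('X_[m] *: 'X^b).
  rewrite aE; first exact: rees_val_mem.
  by rewrite -gE rees_val_eq0.
move=> /rees_memP/(_ b m); apply.
by rewrite coefZ coefXn eqxx mulr1 msuppX mem_head.
Qed.

End Rees.

(* Scaling a packing of [m0 + k m] by [1 / (k + G)], where [G] is the degree of
   [m0], gives a real packing of [m], once the edges meeting the zeros of [m]
   are dropped; for large [k] its value exceeds [b - 1]. *)
Lemma mfmc_saturated (F : realType) : mfmc F C -> packs_saturated.
Proof.
move=> mC m0 m b0 b mk; pose G := mdeg m0.
pose alpha : 'cV[nat]_n := \col_i m i.
have [_ [y [y_int [[y_ge0 y_le] y_max]]]] := mC alpha.
have /choice[Y YE] j : exists k : nat, y j 0 = k%:R.
  by apply/natrP; rewrite natrEint y_int /=; have := y_ge0 j 0; rewrite mxE.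
have rowE (z : 'cV[F]_q) i :
    (incidence F C *m z) i 0 = \sum_j z j 0 * (i \in C j)%:R.
  by rewrite mxE; apply: eq_bigr => j _; rewrite mxE mulrC.
exists Y; split=> [|i]; last first.
  have := y_le i 0; rewrite rowE !mxE -(ler_nat F) natr_sum.
  by congr (_ <= _); apply: eq_bigr => j _; rewrite natrM YE.
(* For b > 0, k > b G amounts to b k - G > (b - 1)(k + G). *)
pose k := (b * G).+1; have [w [w_ge w_le]] := mk k.
pose dead j := [exists i in C j, m i == 0%N].
pose live j := if dead j then 0%N else w j.
pose z : 'cV[F]_q := \col_j ((live j)%:R / (k + G)%:R).
have kG_gt0 : 0 < (k + G)%:R :> F by rewrite ltr0n.
have /y_max : packing (incidence F C) (map_mx (fun l => l%:R) alpha) z.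
  split=> [j i|i j]; first by rewrite !mxE divr_ge0 ?ler0n.
  rewrite (ord1 j) rowE !mxE.
  have -> : \sum_j z j 0 * (i \in C j)%:R =
      (\sum_j live j * (i \in C j))%N%:R / (k + G)%:R.
    rewrite natr_sum mulr_suml; apply: eq_bigr => l _.
    by rewrite mxE natrM mulrAC.
  rewrite ler_pdivrMr // -natrM ler_nat.
  have [mi0|mi_gt0] := posnP (m i).
    rewrite big1 // => l _; rewrite /live; case: ifP => // /existsP ndead.
    case: (boolP (i \in C l)) => [il|_]; last by rewrite muln0.
    by case: ndead; exists i; rewrite il mi0.
  (* Hence m0 + k m is at most (k + G) m at the nonzero coordinates of m. *)
  have le_mG : (m0 i <= m i * G)%N.
    rewrite (leq_trans _ (leq_pmull G mi_gt0)) // /G mdegE.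
    by rewrite (bigD1 i) ?leq_addr.
  apply: (@leq_trans (\sum_j w j * (i \in C j))%N).
    apply: leq_sum => l _; rewrite leq_mul2r /live.
    by case: ifP; rewrite ?leqnn orbT.
  by rewrite (leq_trans (w_le i)) // mnmDE mulmnE mulnDr addnC leq_add2l.
have -> : \sum_j z j 0 = (\sum_j live j)%N%:R / (k + G)%:R.
  by rewrite natr_sum mulr_suml; apply: eq_bigr => j _; rewrite mxE.
have -> : \sum_j y j 0 = (\sum_j Y j)%N%:R.
  by rewrite natr_sum; apply: eq_bigr => j _; rewrite YE.
rewrite ler_pdivrMr // -natrM ler_nat.
(* Each dead edge, counted with multiplicity, consumes a unit of m0 at some zero of m. *)
have dead_le : (\sum_(j | dead j) w j <= G)%N.
  rewrite /G mdegE.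
  apply: (@leq_trans (\sum_(i | m i == 0%N) m0 i)); last first.
    by rewrite [leqRHS](bigID (fun i => m i == 0%N)) leq_addr.
  apply: (@leq_trans (\sum_(i | m i == 0%N) \sum_j w j * (i \in C j)));
      last first.
    apply: leq_sum => i /eqP mi0; have := w_le i.
    by rewrite mnmDE mulmnE mi0 mul0n addn0.
  rewrite exchange_big big_mkcond /=; apply: leq_sum => j _.
  case: ifP => // /existsP[i /andP[ij mi0]].
  by rewrite (bigD1 i) //= ij muln1 leq_addr.
have : (\sum_j w j = \sum_(j | dead j) w j + \sum_j live j)%N.
  rewrite (bigID dead) /=; congr addn; rewrite big_mkcond /=.
  by apply: eq_bigr => j _; rewrite /live; case: (dead j).
rewrite /k in w_ge *.
move: (\sum_j w j)%N (\sum_(j | dead j) w j)%N (\sum_j live j)%N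
  (\sum_j Y j)%N w_ge dead_le.
nia.
Qed.

End Packings.

(** * Fractional packings and the converse *)

Lemma common_denominator (I : finType) (y : I -> rat) : (forall i, 0 <= y i) ->
  exists2 p, (0 < p)%N & exists Y : I -> nat, forall i, y i * p%:R = (Y i)%:R.
Proof.
move=> y_ge0; pose p := (\prod_i `|denq (y i)|)%N.
exists p; first by apply: prodn_gt0 => i; rewrite absz_gt0 denq_neq0.
have /choice[Y YE] i : exists k, y i * p%:R = k%:R; last by exists Y.
apply/natrP; rewrite natrEint mulr_ge0 ?ler0n // andbT.
rewrite /p (bigD1 i) //= natrM mulrA.
apply: rpredM; last exact/intr_nat/natr_nat.
by rewrite pmulrn absz_denq -numqE; apply: intr_int.
Qed.

Section Converse.
Variables (F : realType) (n q : nat) (C : clutter n q).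

Definition covers (w : 'I_n -> nat) : Prop :=
  forall j, (0 < \sum_i w i * (i \in C j))%N.

Lemma covers_polyQ w :
  covers w <-> polyQ (incidence F C) (\row_i (w i)%:R).
Proof.
have rowE j : ((\row_i (w i)%:R) *m incidence F C) 0 j =
    (\sum_i w i * (i \in C j))%N%:R.
  by rewrite mxE natr_sum; apply: eq_bigr => i _; rewrite !mxE natrM.
split=> [cw|[_ cw] j]; last by have := cw 0 j; rewrite rowE mxE ler1n.
by split=> i j; rewrite (ord1 i) ?rowE !mxE ?ler0n // ler1n.
Qed.

Lemma covers_setT : covers (fun=> 1%N).
Proof.
move=> j; have /finset.set0Pn[i ij] := clutter_edge_neq0 C j.
by rewrite (bigD1 i) //= ij.
Qed.

Lemma fractional_packing (m : 'X_{1.. n}) (b : nat) :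
  integral_polyhedron (polyQ (incidence F C)) ->
  (forall w, covers w -> b <= \sum_i m i * w i)%N ->
  exists y : 'I_q -> rat, [/\ forall j, 0 <= y j, b%:R <= \sum_j y j &
    forall i, \sum_j y j * (i \in C j)%:R <= (m i)%:R].
Proof.
move=> intQ b_le.
pose a (i : 'I_q + 'I_n + unit) (k : 'I_q) : rat :=
  match i with
  | inl (inl j) => - (k == j)%:R
  | inl (inr i) => (i \in C k)%:R
  | inr _ => -1
  end.
pose r (i : 'I_q + 'I_n + unit) : rat :=
  match i with inl (inl _) => 0 | inl (inr i) => (m i)%:R | inr _ => - b%:R end.
have [[y yP]|[u [u_ge0 ua ur]]] := farkas a r.
  exists y; split=> [j||i].
  - have := yP (inl (inl j)); rewrite /= (bigD1 j) //= eqxx mulN1r.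
    rewrite big1 ?addr0 ?oppr_le0 // => k /negPf ->.
    by rewrite oppr0 mul0r.
  - have := yP (inr tt); rewrite /= -mulr_sumr mulN1r; lra.
  - have := yP (inl (inr i)); rewrite /=; congr (_ <= _).
    by apply: eq_bigr => j _; rewrite mulrC.
(* In the certificate, s is the multiplier of the value constraint and x those of the capacities; x
   / s is a point of Q(A) of cost below b. *)
exfalso; pose s := u (inr tt); pose x i := u (inl (inr i)).
have xs k : s <= \sum_i x i * (i \in C k)%:R.
  have := ua k; rewrite !big_sumType /= (bigD1 k) //= eqxx.
  rewrite [X in _ + X + _ + _]big1 => [|j]; last first.
    by rewrite eq_sym => /negPf ->; rewrite oppr0 mulr0.
  have /= := u_ge0 (inl (inl k)).
  rewrite (bigD1 tt) //= [X in _ + (_ + X)]big1 => [|[]//].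
  rewrite -/s -[\sum_(i < n) _]/(\sum_i x i * (i \in C k)%:R); lra.
have xm : \sum_i x i * (m i)%:R < s * b%:R.
  move: ur; rewrite !big_sumType /= big1 => [|j _]; last by rewrite mulr0.
  rewrite (bigD1 tt) //= [X in _ + (_ + X)]big1 => [|[]//].
  rewrite -/s -[\sum_(i < n) _]/(\sum_i x i * (m i)%:R); lra.
have x_ge0 i : 0 <= x i by exact: u_ge0.
(* With s = 0 the nonnegative x would have negative cost. *)
have s_gt0 : 0 < s.
  rewrite lt_neqAle u_ge0 andbT; apply: contraTneq xm => <-.
  by rewrite mul0r -leNgt sumr_ge0 // => i _; rewrite mulr_ge0 ?ler0n.
pose X : 'rV[F]_n := \row_i ratr (x i / s).
have [||v v_extr v_le] := @exists_vertex_le F n q (incidence F C)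
    (fun i => (m i)%:R) X.
- by move=> i; apply: ler0n.
- split=> i j; rewrite (ord1 i) !mxE; first by rewrite ler0q divr_ge0 // ltW.
  have -> : \sum_k X 0 k * incidence F C k j =
      ratr ((\sum_i x i * (i \in C j)%:R) / s).
    rewrite mulr_suml rmorph_sum; apply: eq_bigr => k _.
    by rewrite !mxE -(ratr_nat F) -rmorphM mulrAC.
  by rewrite -(rmorph1 (@ratr F)) ler_rat ler_pdivlMr // mul1r.
have [v_pos _] := v_extr.1.
have /choice[w wE] i : exists k : nat, v 0 i = k%:R.
  apply/natrP; rewrite natrEint intQ //=; by have := v_pos 0 i; rewrite mxE.
have vE : v = \row_i (w i)%:R by apply/rowP => i; rewrite wE mxE.
have cw : covers w by apply/covers_polyQ; rewrite -vE; case: v_extr.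
move: (b_le w cw); apply/negP; rewrite -ltnNge -(ltr_nat F).
have -> : (\sum_i m i * w i)%N%:R = \sum_i (m i)%:R * v 0 i.
  by rewrite natr_sum; apply: eq_bigr => i _; rewrite natrM wE.
apply: le_lt_trans v_le _.
have -> : \sum_i (m i)%:R * X 0 i = ratr ((\sum_i x i * (m i)%:R) / s).
  rewrite mulr_suml rmorph_sum; apply: eq_bigr => i _.
  by rewrite mxE -(ratr_nat F) -rmorphM mulrCA mulrA mulrAC.
by rewrite -(ratr_nat F) ltr_rat ltr_pdivrMr // mulrC.
Qed.

(** Both sides are compared with x A y. *)
Lemma weak_duality (alpha : 'cV[F]_n) (x : 'rV[F]_n) (y : 'cV[F]_q) :
  polyQ (incidence F C) x -> packing (incidence F C) alpha y ->
  \sum_j y j 0 <= \sum_i alpha i 0 * x 0 i.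
Proof.
move=> [x_ge0 xA] [y_ge0 Ay].
have x0 i : 0 <= x 0 i by have := x_ge0 0 i; rewrite mxE.
have y0 j : 0 <= y j 0 by have := y_ge0 j 0; rewrite mxE.
apply: (@le_trans _ _ ((x *m incidence F C *m y) 0 0)).
  rewrite mxE; apply: ler_sum => j _; rewrite ler_peMl //.
  by have := xA 0 j; rewrite mxE.
by rewrite -mulmxA mxE; apply: ler_sum => i _; rewrite mulrC ler_wpM2r.
Qed.

Lemma integral_packs_mfmc : integral_polyhedron (polyQ (incidence F C)) ->
  (forall m b p, (0 < p)%N -> packs C (m *+ p)%MM (b * p) -> packs C m b) ->
  mfmc F C.
Proof.
move=> intQ packs_div A alpha alphaF.
pose m : 'X_{1.. n} := [multinom alpha i 0%R | i < n].
pose value k := `[< exists2 w, covers w & (\sum_i m i * w i)%N = k >].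
have [|b /asboolP[w cw wb] b_min] := @ex_minnP value.
  by eexists; apply/asboolP; exists (fun=> 1%N); [exact: covers_setT|].
have [Y [b_le Y_le]] : packs C m b.
  have [|y [y_ge0 y_b y_le]] := @fractional_packing m b intQ.
    by move=> w' cw'; apply: b_min; apply/asboolP; exists w'.
  have [p p_gt0 [Y YE]] := common_denominator y_ge0.
  apply: (packs_div _ _ p) => //; exists Y; split=> [|i].
    rewrite -(ler_nat rat) natr_sum natrM -(eq_bigr _ (fun i _ => YE i)).
    by rewrite -mulr_suml ler_pM2r ?ltr0n.
  rewrite mulmnE -(ler_nat rat) natr_sum natrM.
  under eq_bigr do rewrite natrM -YE mulrAC.
  by rewrite -mulr_suml ler_pM2r ?ltr0n.
pose x : 'rV[F]_n := \row_i (w i)%:R; pose y : 'cV[F]_q := \col_j (Y j)%:R.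
have Qx : polyQ A x by apply/covers_polyQ.
have xb : \sum_i alphaF i 0 * x 0 i = b%:R.
  rewrite -wb natr_sum; apply: eq_bigr => i _.
  by rewrite !mxE mnmE natrM.
have Py : packing A alphaF y.
  split=> [j i|i k]; first by rewrite !mxE ler0n.
  rewrite (ord1 k) !mxE; have := Y_le i; rewrite mnmE -(ler_nat F) natr_sum.
  by congr (_ <= _); apply: eq_bigr => j _; rewrite !mxE natrM mulrC.
have yb : b%:R <= \sum_j y j 0.
  under eq_bigr do rewrite mxE.
  by rewrite -natr_sum ler_nat.
(* The cost of x is b and the value of y is at least b, so weak duality makes both optimal. *)
split; [exists x|exists y]; split.
- by move=> i j; rewrite mxE; apply/intr_nat/natr_nat.
- split=> // x' Qx'; rewrite xb (le_trans yb) //.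
  exact: (weak_duality Qx' Py).
- by move=> i j; rewrite mxE; apply/intr_nat/natr_nat.
- split=> // y' Py'; rewrite (le_trans _ yb) // -xb.
  exact: (weak_duality Qx Py').
Qed.

End Converse.

Theorem theorem3p4 (K : fieldType) (F : realType) (n q : nat)
    (C : clutter n q) :
  mfmc F C <->
  integral_polyhedron (polyQ (incidence F C)) /\
  normal_domain (rees_algebra (edge_ideal K C)).
Proof.
split=> [mC|[intQ normal]].
  split; first exact: mfmc_integral.
  exact/saturated_normal/mfmc_saturated/mC.
by apply: integral_packs_mfmc => // m b p; apply: normal_packs normal.
Qed.
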